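(* Let $S$ be a finite nonempty set of customers, with independent non-negative random demands and depot distances $c_{0i}$, respecting the monotonicity condition. Let $\mathcal{P}^1(S)$ be the set of all paths visiting each customer of $S$ exactly once (and no other customer), and let $p^*=(i^*_1,\dots,i^*_{|S|})\in\mathcal{P}^1(S)$ be such that $c_{0i^*_1}\ge c_{0i^*_2}\ge\dots\ge c_{0i^*_{|S|}}$. Then $\mathcal{Q}(p^* )\le\mathcal{Q}(p)$ for every path $p\in\mathcal{P}^1(S)$.
   Context: $Q>0$ is the vehicle capacity; each customer $i$ has a non-negative random demand $\xi_i$ with finite mean, demands being independent; $c_{0i}\ge0$ is the travel cost between the depot $0$ and customer $i$. For a path (sequence of distinct customers) $p=(i_1,\dots,i_t)$, the expected recourse cost in the given orientation is $\mathcal{Q}^1(p)=2\sum_{j=1}^t\sum_{l=1}^\infty\mathbb{P}\left(\sum_{k=1}^{j-1}\xi_{i_k}\le lQ<\sum_{k=1}^{j}\xi_{i_k}\right)c_{0i_j}$; $\mathcal{Q}^2(p)$ is the same quantity for the reversed path $(i_t,\dots,i_1)$; and $\mathcal{Q}(p)=\min\{\mathcal{Q}^1(p),\mathcal{Q}^2(p)\}$. Monotonicity condition: $S$ respects it if for all $a\ne b$ in $S$, all $\tilde S\subseteq S\setminus\{a,b\}$ and all integers $l\ge1$, with $\tilde\xi=\sum_{i\in\tilde S}\xi_i$, $\mathbb{P}(\tilde\xi+\xi_a\le lQ<\tilde\xi+\xi_a+\xi_b)\ge\mathbb{P}(\tilde\xi\le lQ<\tilde\xi+\xi_b)$. *)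

(* Defs.v *)
From mathcomp Require Import all_boot all_order all_algebra.
From mathcomp Require Import all_classical all_reals all_analysis.

Set Implicit Arguments.
Unset Strict Implicit.
Unset Printing Implicit Defensive.

Import Order.TTheory GRing.Theory Num.Theory.

Local Open Scope classical_set_scope.
Local Open Scope ring_scope.
Local Open Scope ereal_scope.

Definition mutually_independent (d : measure_display) (T : measurableType d)
    (R : realType) (P : probability T R) (I : finType) (S : {set I})
    (xi : I -> {RV P >-> R}) : Prop :=
  forall (J : {set I}) (B : I -> set R), J \subset S ->
    (forall i, i \in J -> measurable (B i)) ->
    P [set w | forall i, i \in J -> xi i w \in B i] =
    \prod_(i in J) P (xi i @^-1` B i).

Definition monotonicity_condition (d : measure_display) (T : measurableType d)
    (R : realType) (P : probability T R) (I : finType) (S : {set I})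
    (xi : I -> {RV P >-> R}) (Q : R) : Prop :=
  forall (a b : I) (S' : {set I}) (l : nat),
    a \in S -> b \in S -> a != b -> S' \subset S :\ a :\ b -> (1 <= l)%N ->
    let tot := fun w => (\sum_(i in S') xi i w)%R in
    P [set w | (tot w <= l%:R * Q < tot w + xi b w)%R] <=
    P [set w | (tot w + xi a w <= l%:R * Q < tot w + xi a w + xi b w)%R].

(* Positions are 0-based: [take j p] lists the customers visited strictly before
   the customer at position [j].  The series over [l] is taken in [\bar R], so
   that it is well defined for non-negative costs without a summability proof;
   [recourse_oriented] is the cost in the given orientation, and the cost in
   the opposite orientation is its value at [rev p]. *)
Definition recourse_oriented (d : measure_display) (T : measurableType d)
    (R : realType) (P : probability T R) (I : finType)
    (xi : I -> {RV P >-> R}) (Q : R) (c0 : I -> R) (p : seq I) : \bar R :=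
  2%:E * \sum_(j < size p) \sum_(1 <= l <oo)
    (P [set w | (\sum_(i <- take j p) xi i w <= l%:R * Q
                 < \sum_(i <- take j.+1 p) xi i w)%R]
     * (c0 (tnth (in_tuple p) j))%:E).

Definition recourse (d : measure_display) (T : measurableType d)
    (R : realType) (P : probability T R) (I : finType)
    (xi : I -> {RV P >-> R}) (Q : R) (c0 : I -> R) (p : seq I) : \bar R :=
  Order.min (recourse_oriented xi Q c0 p) (recourse_oriented xi Q c0 (rev p)).

Definition covering_path (I : finType) (S : {set I}) (p : seq I) : Prop :=
  uniq p /\ p =i S.

(* Main.v *)
(** For a fixed threshold [q = l Q], write [G A] for the probability that the
    total demand of the customers [A] does not exceed [q].  As demands are almost
    surely non-negative, the probability of failing at [x] after having served
    [A] is [G A - G (A + x)].  Hence swapping two consecutive customers only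
    transfers probability mass between them, and monotonicity says that the
    customer served second gains mass: it is better to serve the farther one
    first.  Bubbling each customer of the sorted path to the front of what is
    left of [p] shows that the sorted path minimizes the cost for every [l], in
    the given orientation; since the reverse of [p] also covers [S], both terms
    of the minimum defining the cost of [p] are bounded below. *)

Require Import Defs.
From mathcomp Require Import all_boot all_order all_algebra.
From mathcomp Require Import all_classical all_reals all_analysis.
From mathcomp Require Import lra.

Set Implicit Arguments.
Unset Strict Implicit.
Unset Printing Implicit Defensive.

Import Order.TTheory GRing.Theory Num.Theory.

Local Open Scope classical_set_scope.
Local Open Scope ring_scope.

Section SequentialCost.
Context {R : realFieldType} {I : eqType}.
Variables (G : seq I -> R) (c : I -> R) (D : {pred I}).

(** [A] records the customers already served. With [G] abstract, the exchange argument needs no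
    probability: invariance under permutation and [G_mono] suffice. *)
Fixpoint sequential_cost (A s : seq I) : R :=
  if s is x :: s' then
    (G A - G (rcons A x)) * c x + sequential_cost (rcons A x) s'
  else 0.

Hypothesis G_perm : forall A B, perm_eq A B -> G A = G B.
Hypothesis G_mono : forall A a b, uniq [:: a, b & A] ->
  {subset [:: a, b & A] <= D} ->
  G A - G (rcons A b) <= G (rcons A a) - G (rcons (rcons A a) b).

Lemma sequential_cost_perm A B s : perm_eq A B ->
  sequential_cost A s = sequential_cost B s.
Proof.
elim: s A B => //= x s IHs A B AB.
have ABx : perm_eq (rcons A x) (rcons B x) by rewrite -!cats1 perm_cat2r.
by rewrite (G_perm AB) (G_perm ABx) (IHs _ _ ABx).
Qed.

Lemma sequential_cost_swap A a b s : uniq [:: a, b & A] ->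
  {subset [:: a, b & A] <= D} -> c b <= c a ->
  sequential_cost A [:: a, b & s] <= sequential_cost A [:: b, a & s].
Proof.
move=> uA sA cba.
have pab : perm_eq (rcons (rcons A a) b) (rcons (rcons A b) a).
  by rewrite -!cats1 -!catA perm_cat2l perm_catC.
rewrite /= (sequential_cost_perm s pab) !addrA lerD2r (G_perm pab).
have := G_mono uA sA; rewrite (G_perm pab).
move: (G A) (G (rcons A a)) (G (rcons A b)) (G (rcons (rcons A b) a)).
move=> u v w z Gm.
(* This product is exactly the cost of serving [b] first minus that of serving [a] first. *)
have : 0 <= (v - z - (u - w)) * (c a - c b) by rewrite mulr_ge0 ?subr_ge0.
lra.
Qed.

(** Induction on [s1]: with its head [y] counted as served, [x] moves up to just behind [y]; one
    swap then passes [y]. *)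
Lemma sequential_cost_front A x s1 s2 : uniq (A ++ x :: s1) ->
  {subset A ++ x :: s1 <= D} -> {in s1, forall y, c y <= c x} ->
  sequential_cost A (x :: s1 ++ s2) <= sequential_cost A (s1 ++ x :: s2).
Proof.
elim: s1 A => // y s1 IHs A uA sA cx.
have pA : perm_eq (A ++ [:: x, y & s1]) (rcons A y ++ x :: s1).
  by rewrite cat_rcons perm_cat2l (perm_catCA [:: x] [:: y]).
have sub : {subset [:: x, y & A] <= A ++ [:: x, y & s1]}.
  by move=> z; rewrite !(inE, mem_cat) => /or3P[] ->; rewrite ?orbT.
apply: (@le_trans _ _ (sequential_cost A [:: y, x & s1 ++ s2])).
  apply: sequential_cost_swap.
  - move: uA; rewrite -[[:: x, y & s1]]/([:: x; y] ++ s1) catA cat_uniq => /andP[+ _].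
    by rewrite uniq_catC.
  - by move=> z /sub /sA.
  - by apply: cx; rewrite inE eqxx.
rewrite [leRHS]/= [leLHS]/= lerD2l; apply: IHs.
- by rewrite -(perm_uniq pA).
- by move=> z; rewrite -(perm_mem pA) => /sA.
- by move=> z zs; apply: cx; rewrite inE zs orbT.
Qed.

(** A selection sort of [t]: the head of [s] has the largest [c], so moving it to the front of [t]
    does not raise the cost. The tails are compared by induction, with [A] extended by that head. *)
Lemma sequential_cost_sorted_min A s t : uniq (A ++ s) ->
  {subset A ++ s <= D} -> sorted (fun i k => c k <= c i) s -> perm_eq s t ->
  sequential_cost A s <= sequential_cost A t.
Proof.
elim: s A t => [|x s IHs] A t uA sA.
  by move=> _; rewrite perm_sym => /perm_nilP ->.
have c_trans : transitive (fun i k => c k <= c i).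
  by move=> j i k ji kj; apply: le_trans kj ji.
move=> /= xs st.
have /splitPr def_t : x \in t by rewrite -(perm_mem st) inE eqxx.
case: def_t st => t1 t2.
rewrite perm_sym -cat1s perm_catCA perm_cons => ts.
have t1s : {subset t1 <= s} by move=> y yt; rewrite -(perm_mem ts) mem_cat yt.
have ps : perm_eq (A ++ x :: s) (A ++ x :: t1 ++ t2).
  by rewrite perm_cat2l perm_cons perm_sym.
apply: (@le_trans _ _ (sequential_cost A (x :: t1 ++ t2))).
  rewrite /= lerD2l; apply: IHs.
  - by rewrite cat_rcons.
  - by move=> y; rewrite cat_rcons => /sA.
  - exact: path_sorted xs.
  - by rewrite perm_sym.
apply: sequential_cost_front.
- move: uA; rewrite (perm_uniq ps) -[x :: _]/((x :: t1) ++ t2) catA cat_uniq.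
  by case/andP.
- move=> y yA; apply: sA; rewrite (perm_mem ps).
  by rewrite -[x :: _]/((x :: t1) ++ t2) catA mem_cat yA.
- by move=> y /t1s ys; have /allP/(_ _ ys) := order_path_min c_trans xs.
Qed.

Lemma sequential_costE x0 A s : sequential_cost A s =
  \sum_(j < size s) (G (A ++ take j s) - G (A ++ take j.+1 s)) * c (nth x0 s j).
Proof.
elim: s A => [|x s IHs] A /=; first by rewrite big_ord0.
rewrite big_ord_recl /= take0 cats0 cats1 IHs; congr (_ + _).
by apply: eq_bigr => j _; rewrite /= !cat_rcons.
Qed.

End SequentialCost.

Section DemandThreshold.
Context {d : measure_display} {T : measurableType d} {R : realType}.
Variables (P : probability T R) (I : finType) (S : {set I}).
Variables (xi : I -> {RV P >-> R}).
Hypothesis xi_ge0 : forall i, i \in S -> {ae P, forall w, 0 <= xi i w}.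

Definition demand_le (q : R) (A : seq I) : set T :=
  [set w | \sum_(i <- A) xi i w <= q].

Definition prob_demand_le (q : R) (A : seq I) : R := fine (P (demand_le q A)).

Lemma measurable_demand_le q A : measurable (demand_le q A).
Proof.
have mX : measurable_fun setT (fun w => \sum_(i <- A) xi i w).
  exact: measurable_sum.
have := mX measurableT _ (@measurable_itv R `]-oo, q]).
rewrite setTI; congr (measurable _).
Qed.

Lemma prob_demand_le_perm q A B :
  perm_eq A B -> prob_demand_le q A = prob_demand_le q B.
Proof.
move=> AB; rewrite /prob_demand_le; congr (fine (P _)).
by apply/funext => w; rewrite /demand_le /= (perm_big _ AB).
Qed.

(** The crossing event is a set difference. Its probability is a difference of probabilities because
    [demand_le q (rcons A x)] lies in [demand_le q A] up to the null set where [xi x] is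
    negative. *)
Lemma prob_threshold_crossing q A x : x \in S ->
  P [set w | \sum_(i <- A) xi i w <= q < \sum_(i <- rcons A x) xi i w] =
  (prob_demand_le q A - prob_demand_le q (rcons A x))%:E.
Proof.
move=> xS.
have mA := measurable_demand_le q A; have mB := measurable_demand_le q (rcons A x).
have -> : [set w | \sum_(i <- A) xi i w <= q < \sum_(i <- rcons A x) xi i w] =
    demand_le q A `\` demand_le q (rcons A x).
  apply/seteqP; split => w; rewrite /demand_le /= ltNge.
    by case/andP => -> /negP.
  by case=> -> /negP.
have null : P (demand_le q (rcons A x) `\` demand_le q A) = 0%E.
  apply/measure_negligible; first exact: measurableD.
  apply: negligibleS (xi_ge0 xS) => w []; rewrite /demand_le /=.
  rewrite -cats1 big_cat big_seq1 /= => le_q nle_q x_ge0; apply: nle_q.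
  by apply: le_trans le_q; rewrite lerDl.
have PE : P (demand_le q A `&` demand_le q (rcons A x)) =
    P (demand_le q (rcons A x)).
  by rewrite [RHS](measureDI P mB mA) [X in (X + _)%E]null add0e setIC.
rewrite measureD //; last by rewrite ltey_eq fin_num_measure.
by rewrite [X in (_ - X)%E]PE EFinB !fineK ?fin_num_measure.
Qed.

(** Supplies [G_mono]: since [A] has no repetition, its sum equals the sum over its set of entries,
    to which the monotonicity condition applies. *)
Lemma prob_demand_le_mono (Q : R) (l : nat) A a b :
  monotonicity_condition S xi Q -> (1 <= l)%N -> uniq [:: a, b & A] ->
  {subset [:: a, b & A] <= S} ->
  let G := prob_demand_le (l%:R * Q) in
  G A - G (rcons A b) <= G (rcons A a) - G (rcons (rcons A a) b).
Proof.
move=> mono l1 /= /and3P[aA bA uA] sA.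
have aS : a \in S by apply: sA; rewrite inE eqxx.
have bS : b \in S by apply: sA; rewrite !inE eqxx orbT.
move: aA; rewrite inE negb_or => /andP[ab aA].
have sub : finset.finset (mem A) \subset S :\ a :\ b.
  apply/fintype.subsetP => y; rewrite !inE => yA.
  rewrite sA ?inE ?yA ?orbT // andbT; apply/andP; split.
    by apply: contraNneq bA => <-.
  by apply: contraNneq aA => <-.
have := mono a b _ l aS bS ab sub l1.
have sumE w : \sum_(i in finset.finset (mem A)) xi i w = \sum_(i <- A) xi i w.
  by rewrite (big_uniq _ uA); apply: eq_bigl => i; rewrite inE.
rewrite -lee_fin -!prob_threshold_crossing //=.
under eq_set do rewrite sumE.
under [X in (_ <= P X)%E -> _]eq_set do rewrite sumE.
congr (P _ <= P _)%E; apply/funext => w /=;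
  by rewrite -!cats1 !big_cat !big_seq1.
Qed.

Lemma recourse_orientedE (Q : R) (c0 : I -> R) (p : seq I) :
  {subset p <= S} -> (forall i, i \in S -> 0 <= c0 i) ->
  recourse_oriented xi Q c0 p =
  (2%:E * \sum_(1 <= l <oo)
    (sequential_cost (prob_demand_le (l%:R * Q)) c0 [::] p)%:E)%E.
Proof.
move=> pS c0_ge0; rewrite /recourse_oriented; congr (_ * _)%E.
have tS (j : 'I_(size p)) : tnth (in_tuple p) j \in S by apply/pS/mem_tnth.
(* Non-negative terms allow exchanging the series over [l] with the sum over positions, so that
   paths can be compared for each [l] separately. *)
rewrite -nneseries_sum; last first.
  by move=> j l _; apply: mule_ge0 => //; rewrite lee_fin c0_ge0.
apply: eq_eseriesr => l _; case: p pS tS => [|x0 p'] pS tS.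
  by rewrite big_ord0.
rewrite (sequential_costE _ _ x0) -sumEFin; apply: eq_bigr => j _.
rewrite !cat0s EFinM (tnth_nth x0) (take_nth x0) //.
by rewrite prob_threshold_crossing // -(tnth_nth x0 (in_tuple (x0 :: p'))).
Qed.

Lemma recourse_oriented_sorted_min (Q : R) (c0 : I -> R) (s p : seq I) :
  (forall i, i \in S -> 0 <= c0 i) -> monotonicity_condition S xi Q ->
  covering_path S s -> sorted (fun i k => c0 k <= c0 i) s ->
  covering_path S p ->
  (recourse_oriented xi Q c0 s <= recourse_oriented xi Q c0 p)%E.
Proof.
move=> c0_ge0 mono [us sS] s_sorted [up pS].
have sp : perm_eq s p by apply: uniq_perm => // i; rewrite sS pS.
have ssub : {subset s <= S} by move=> i; rewrite sS.
have psub : {subset p <= S} by move=> i; rewrite pS.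
have cost_ge0 (t : seq I) l : {subset t <= S} ->
    0 <= sequential_cost (prob_demand_le (l%:R * Q)) c0 [::] t.
  case: t => // x0 t tS; rewrite (sequential_costE _ _ x0) sumr_ge0 // => j _.
  have xS : nth x0 (x0 :: t) j \in S by apply/tS/mem_nth.
  rewrite mulr_ge0 ?c0_ge0 // (take_nth x0) // !cat0s.
  by rewrite -lee_fin -prob_threshold_crossing.
rewrite !recourse_orientedE //; apply: lee_wpmul2l; first by rewrite lee_fin.
(* The bound on [l] becomes a condition on the index, available in the termwise comparison:
   monotonicity is assumed only for [l] at least 1. *)
rewrite [leLHS]eseries_cond [leRHS]eseries_cond.
apply: lee_nneseries => [l _ _|l /= l1]; first by rewrite lee_fin cost_ge0.
rewrite lee_fin; apply: (@sequential_cost_sorted_min _ _ _ _ (mem S)) => //.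
- exact: prob_demand_le_perm.
- by move=> A a b; exact: prob_demand_le_mono.
Qed.

End DemandThreshold.

Local Open Scope ereal_scope.

Theorem proposition13 (d : measure_display) (T : measurableType d)
    (R : realType) (P : probability T R) (I : finType) (S : {set I})
    (xi : I -> {RV P >-> R}) (Q : R) (c0 : I -> R) (pstar : seq I)
    (S_neq0 : S != finset.set0)
    (Q_gt0 : (0 < Q)%R)
    (c0_ge0 : forall i : I, i \in S -> (0 <= c0 i)%R)
    (xi_ge0 : forall i : I, i \in S -> {ae P, forall w, (0 <= xi i w)%R})
    (xi_mean : forall i : I, i \in S -> P.-integrable setT (EFin \o xi i))
    (xi_indep : mutually_independent S xi)
    (S_mono : monotonicity_condition S xi Q)
    (pstar_path : covering_path S pstar)
    (pstar_sorted : sorted (fun i k : I => (c0 k <= c0 i)%R) pstar) :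
  forall p : seq I, covering_path S p ->
    recourse xi Q c0 pstar <= recourse xi Q c0 p.
Proof.
move=> p pP; have rpP : covering_path S (rev p).
  by case: pP => up pS; split=> [|i]; rewrite ?rev_uniq ?mem_rev.
have min_pstar t : covering_path S t ->
    recourse_oriented xi Q c0 pstar <= recourse_oriented xi Q c0 t.
  exact: recourse_oriented_sorted_min.
(* The given orientation of [pstar] alone is already below both orientations of [p]. *)
by rewrite /recourse ge_min le_min !min_pstar.
Qed.
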